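(* There is an absolute constant $C$ such that for every integer $n>3$ and every $n$-vertex maximal outerplanar graph $G$, $f(G) \le \frac{n}{4} + C$. Moreover, this is tight up to an additive constant: for the fan graph $F_n$ (which is maximal outerplanar), $f(F_n) \ge \frac{n-1}{4}$.
   Context: $\log$ is base 2. A maximal outerplanar graph is a triangulation of a convex polygon (an outerplanar graph to which no edge can be added preserving outerplanarity). The fan graph $F_n$ consists of a path on $n-1$ vertices together with an additional apex vertex adjacent to all vertices of the path. A path in a graph $G$ is a sequence of distinct vertices $v_0,\dots,v_r$ ($r\ge0$) with consecutive vertices adjacent. A vertex-separating path system of $G$ is a collection of distinct paths in $G$ such that for every pair of distinct vertices $u,v$ some path in the collection contains exactly one of $u$ and $v$. $f(G)$ denotes the minimum size of such a system. *)

(* Defs.v *)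
From HB Require Import structures.
From mathcomp Require Import all_boot all_order all_algebra.
Set Implicit Arguments.
Unset Strict Implicit.
Unset Printing Implicit Defensive.

Definition simple_graph (V : finType) (e : rel V) : Prop :=
  symmetric e /\ irreflexive e.

(* The corners of a convex polygon are numbered 0, ..., n-1 in cyclic order.
   Two chords (a, b) and (c, d) cross in the interior of the polygon iff they
   separate each other, i.e. one of c, d lies strictly between a and b and
   the other strictly outside. *)
Definition chords_cross (n : nat) (a b c d : 'I_n) : bool :=
  let inside (x : 'I_n) := minn a b < x < maxn a b in
  let outside (x : 'I_n) := (x < minn a b) || (maxn a b < x) in
  (inside c && outside d) || (outside c && inside d).

(* A triangulation of a convex polygon: the vertices are placed bijectively on
   its corners, all sides are edges (ordS is the cyclic successor), no two
   edges cross, and the set of edges is maximal with that property, i.e. no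
   further chord can be drawn without crossing an edge. *)
Definition maximal_outerplanar (V : finType) (e : rel V) : Prop :=
  [/\ simple_graph e, 2 < #|V| &
      exists corner : 'I_#|V| -> V,
      [/\ bijective corner,
          forall i, e (corner i) (corner (ordS i)),
          forall a b c d, e (corner a) (corner b) -> e (corner c) (corner d) ->
            ~~ chords_cross a b c d
        & forall a b, a != b -> ~~ e (corner a) (corner b) ->
            exists c d, e (corner c) (corner d) && chords_cross a b c d]].

(* None is the apex, and Some 0, ..., Some (n - 2) is the path. *)
Definition fan (n : nat) : rel (option 'I_n.-1) := fun u v =>
  match u, v with
  | None, None => false
  | None, Some _ | Some _, None => true
  | Some i, Some j => (i.+1 == j) || (j.+1 == i)
  end.

Definition is_path (V : finType) (e : rel V) (p : seq V) : bool :=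
  if p is x :: s then path e x s && uniq p else false.

(* The bound on the length of the sequences loses nothing, since the vertices
   of a path are distinct; it makes the type of candidate paths finite. *)
Definition vertex_separating_path_system (V : finType) (e : rel V)
    (S : {set {bseq #|V| of V}}) : bool :=
  [forall p in S, is_path e p] &&
  [forall u, forall v, (u != v) ==>
     [exists p in S, (u \in (p : seq V)) (+) (v \in (p : seq V))]].

Definition all_paths (V : finType) (e : rel V) : {set {bseq #|V| of V}} :=
  [set p : {bseq #|V| of V} | is_path e p].

(* The minimum size of a vertex-separating path system; the default value
   required by arg min, the set of all paths, is always such a system. *)
Definition vsp_number (V : finType) (e : rel V) : nat :=
  #|[arg min_(S < all_paths e | vertex_separating_path_system e S) #|S|]|.

Lemma all_paths_system (V : finType) (e : rel V) :
  vertex_separating_path_system e (all_paths e).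
Proof.
apply/andP; split; first by apply/forall_inP => p; rewrite inE.
apply/forallP => u; apply/forallP => v; apply/implyP => neq_uv.
have szu : size [:: u] <= #|V| by apply/card_gt0P; exists u.
apply/existsP; exists (Bseq szu).
by rewrite !inE /= eqxx eq_sym (negbTE neq_uv).
Qed.

Lemma vsp_number_attained (V : finType) (e : rel V) :
  exists2 S : {set {bseq #|V| of V}},
    vertex_separating_path_system e S & #|S| = vsp_number e.
Proof.
rewrite /vsp_number; case: arg_minnP => [|S sepS _]; last by exists S.
exact: all_paths_system.
Qed.

Lemma vsp_number_min (V : finType) (e : rel V) (S : {set {bseq #|V| of V}}) :
  vertex_separating_path_system e S ->
  vsp_number e <= #|S|.
Proof.
rewrite /vsp_number; case: arg_minnP => [|S0 _ minS0 /minS0 //].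
by rewrite all_paths_system.
Qed.

Lemma card_fan (n : nat) : 0 < n -> #|{: option 'I_n.-1}| = n.
Proof. by move=> n_gt0; rewrite card_option card_ord prednK. Qed.

(* Main.v *)
Require Import Defs.
From HB Require Import structures.
From mathcomp Require Import all_boot all_order all_algebra zify.
Set Implicit Arguments.
Unset Strict Implicit.
Unset Printing Implicit Defensive.

(* Upper bound.  The vertices of a maximal outerplanar graph lie on a
   Hamiltonian cycle, and some triangle a b d cuts this cycle into three arcs
   of at most n / 2 vertices.  Consider one arc, numbered 0, ..., N with its two
   corners 0 and N.  Call i a jump if it has a neighbour beyond i + 1; let
   r_1 < ... < r_K be the jumps, r_0 = 0 and k about K / 2.  The half-path S_i
   runs along the arc from r_i + 1 to r_(i + k), then climbs to N by longest
   edges, meeting exactly the vertices v > r_(i + k) not lying below an edge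
   that starts at or after r_(i + k).  These k + 1 half-paths separate u < v
   whenever v lies below an edge starting in [u, v).  The mirror images, ending
   at 0, separate the other pairs, because of the triangle on the outer side of
   an edge.  An edge i i+1 cannot count as a jump on both sides, so an arc with m
   vertices needs only m / 2 + O(1) half-paths.  Half-paths of different arcs can
   be joined through their final corners, which are equal or adjacent; pairing
   them up leaves n / 4 + O(1) paths.

   Lower bound.  Close the path of the fan up to a cycle.  A path of the fan
   meets this cycle in at most two intervals, so it separates at most four of
   its n - 1 pairs of consecutive vertices. *)

(** * Triangulated polygons on the indices 0, ..., N *)

(** The polygon has the corners 0, ..., N in order. For [0 < N] the closing side [0 N] is forced by
    the last clause, since no corner lies outside the whole range. *)
Definition triangulated (E : rel nat) (N : nat) : Prop :=
  [/\ forall i, i < N -> E i i.+1,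
      forall i j k l, i < j -> j < k -> k < l -> l <= N -> E i k -> E j l -> False
    & forall i j, i < j -> j <= N -> ~~ E i j ->
        exists c d, [/\ i < c < j, (d < i) || (j < d <= N) & E c d]].

Definition covered (E : rel nat) N r v :=
  has (fun z => has (E z) (iota v.+1 (N - v))) (iota r (v - r)).

Lemma coveredP (E : rel nat) N r v :
  reflect (exists z j, [/\ r <= z < v, v < j <= N & E z j]) (covered E N r v).
Proof.
apply: (iffP hasP) => [[z]|[z [j [rzv vjN Ezj]]]].
  rewrite mem_iota => rz /hasP[j]; rewrite mem_iota => vj Ezj.
  by exists z, j; split=> //; lia.
exists z; first by rewrite mem_iota; lia.
by apply/hasP; exists j => //; rewrite mem_iota; lia.
Qed.

Lemma covered_anti (E : rel nat) N r r' v : r <= r' -> covered E N r' v -> covered E N r v.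
Proof.
move=> rr' /coveredP[z [j [h1 h2 Ezj]]]; apply/coveredP; exists z, j; split=> //; lia.
Qed.

(** From [r], go to the farthest neighbour [q] and repeat. Corners strictly between [r] and [q] lie
    below the edge [r q], while [q] lies below no edge starting at or after [r], by the choice of
    [q] and because edges do not cross. *)
Lemma up_chain (E : rel nat) N r : triangulated E N -> r < N ->
  exists t, [/\ path E r t, last r t = N, path ltn r t
              & forall v, (v \in t) = (r < v <= N) && ~~ covered E N r v].
Proof.
move=> [side ncr _]; have [k] := ubnP (N - r).
elim: k r => // k IH r Hk rN.
have exQ : exists j, E r j && (j <= N) by exists r.+1; rewrite side.
have ubQ j : E r j && (j <= N) -> j <= N by case/andP.
case: (ex_maxnP exQ ubQ) => q /andP[Erq qN] maxq.
have rq : r < q by apply: maxq; rewrite side.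
(* An edge over [v] that starts in [[r, q)] would give [r] a farther neighbour than [q], or cross
   [r q]. *)
have coveredq v : q <= v -> covered E N r v = (covered E N q v).
  move=> qv; apply/coveredP/coveredP=> -[z [j [h1 h2 Ezj]]]; last by exists z, j; split=> //; lia.
  exists z, j; split=> //; have [|zq] := leqP q z; first lia.
  have [zr|zr] := eqVneq z r.
    by have := maxq j; rewrite -{1}zr Ezj; lia.
  by case: (ncr r z q j) => //; lia.
have notq : ~~ covered E N r q by rewrite coveredq //; apply/coveredP=> -[z [j []]]; lia.
have below v : r < v < q -> covered E N r v.
  by move=> h; apply/coveredP; exists r, q; split=> //; lia.
have [qeN|qN'] := eqVneq q N.
  subst q; exists [:: N]; rewrite /= Erq rq; split=> // v; rewrite inE.
  have [->|vN] := eqVneq v N; first by rewrite rq leqnn notq.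
  have [h /=|//] := boolP (r < v <= N).
  by apply/esym/negbF; apply: below; lia.
have [||t [pt lt st mt]] := IH q; try lia.
exists (q :: t); rewrite /= Erq rq; split=> // v; rewrite inE mt.
have [->|vq] := eqVneq v q; first by rewrite rq qN notq.
case: (ltnP q v) => qv /=.
  by rewrite coveredq ?(ltnW qv) //; congr (_ && _); lia.
by case: (ltnP r v) => //= rv; rewrite below ?andbF //; lia.
Qed.

(* j is the third vertex of the triangle on the outer side of the edge a b. *)
Lemma outer_triangle (E : rel nat) N a b : symmetric E -> triangulated E N ->
  0 < a -> a < b -> b < N -> E a b ->
  (exists2 j, b < j <= N & E a j) \/ (exists2 j, j < a & E j b).
Proof.
move=> symE [side ncr maxE] a0 ab bN Eab.
have Ea : E a a.-1 by rewrite symE -{2}(prednK a0); apply: side; lia.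
have exP : exists p, E a p by exists a.-1.
(* If [p b] is not an edge, some edge crosses it. That edge ends at [a], as any other would cross
   [p a] or [a b]; by minimality of [p] its other end lies beyond [b]. *)
case: (ex_minnP exP) => p Eap minp.
have pa : p < a by have := minp _ Ea; lia.
have [Epb|nEpb] := boolP (E p b); first by right; exists p.
have [||c [d [pcb dout Ecd]]] := maxE p b _ _ nEpb; try lia.
have [ca|ca] := eqVneq c a.
  case/orP: dout => [dp|bd]; last by left; exists d; rewrite // -ca.
  by have := minp d; rewrite -{1}ca Ecd; lia.
have Edc : E d c by rewrite symE.
have Epa : E p a by rewrite symE.
exfalso; case/orP: dout => [dp|/andP[bd dN]]; have [cla|ac] := ltnP c a.
- by apply: (ncr d p c a); lia.
- by apply: (ncr d a c b); lia.
- by apply: (ncr p c a d); lia.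
- by apply: (ncr a c b d); lia.
Qed.

(** Let [t] be the last neighbour of [a] before [b]. An edge crossing [t b] would cross [a t] or
    [a b], or join [a] to a later neighbour before [b]. *)
Lemma inner_triangle (E : rel nat) N a b : symmetric E -> triangulated E N ->
  a.+1 < b -> b <= N -> E a b -> exists t, [/\ a < t < b, E a t & E t b].
Proof.
move=> symE [side ncr maxE] ab bN Eab.
have exQ : exists t, E a t && (t < b) by exists a.+1; rewrite side // (leq_trans _ bN) //; lia.
have ubQ t : E a t && (t < b) -> t <= b by case/andP=> _ /ltnW.
case: (ex_maxnP exQ ubQ) => t /andP[Eat tb] maxt.
have at' : a < t by apply: maxt; rewrite side; lia.
exists t; split=> //; first lia.
apply: contraT => /(maxE _ _ tb bN)[c [d [tcb dout Ecd]]].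
have Edc : E d c by rewrite symE.
exfalso; case/orP: dout => [dt|/andP[bd dN]]; last by apply: (ncr a c b d); lia.
case: (ltngtP d a) => da.
- by apply: (ncr d a c b); lia.
- by apply: (ncr a d t c); lia.
- by have := maxt c; rewrite -{1}da Edc; lia.
Qed.

(* Meaningful only on indices up to N. *)
Definition mirror (E : rel nat) N : rel nat := fun i j => E (N - i) (N - j).

Lemma triangulated_mirror (E : rel nat) N : symmetric E -> triangulated E N ->
  triangulated (mirror E N) N.
Proof.
move=> symE [side ncr maxE]; rewrite /mirror; split.
- by move=> i iN; rewrite symE; have := side (N - i.+1); rewrite subnSK //; apply; lia.
- move=> i j k l ij jk kl lN Eik Ejl.
  by apply: (ncr (N - l) (N - k) (N - j) (N - i)); 
    rewrite ?[E (N - l) _]symE ?[E (N - k) _]symE; lia.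
- move=> i j ij jN nE; rewrite symE in nE.
  have [||c [d [icj dout Ecd]]] := maxE _ _ _ _ nE; try lia.
  have [dN|dN] := leqP d N; last lia.
  by exists (N - c), (N - d); rewrite !subKn; try lia; split=> //; lia.
Qed.

(** Let [t] be the last neighbour of [u] not beyond [v]. The outer triangle at [u t] gives an edge
    from [u] to beyond [t], hence beyond [v], or an edge from [t] to before [u], which covers [u] in
    the mirror image. *)
Lemma covered_or (E : rel nat) N u v :
  symmetric E -> triangulated E N -> 0 < u -> u < v -> v < N ->
  covered E N u v || covered (mirror E N) N (N - v) (N - u).
Proof.
move=> symE triE u0 uv vN; apply/orP.
have [side ncr maxE] := triE.
have exQ : exists t, E u t && (t <= v) by exists u.+1; rewrite side //; lia.
have ubQ t : E u t && (t <= v) -> t <= v by case/andP.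
case: (ex_maxnP exQ ubQ) => t /andP[Eut tv] maxt.
have ut : u < t by apply: maxt; rewrite side; lia.
have tN : t < N by lia.
have [[j h Euj]|[j h Ejt]] := outer_triangle symE triE u0 ut tN Eut.
  left; apply/coveredP; exists u, j; split=> //; first lia.
  by have := maxt j; rewrite Euj; lia.
right; apply/coveredP; exists (N - t), (N - j); split; try lia.
by rewrite /mirror !subKn ?[E t j]symE //; lia.
Qed.

(** * The half-paths of one arc *)

(** The corners met by a half-path: a walk from [lo] to [hi], empty if [hi < lo], followed by the
    climb from [hi] to [N]. *)
Definition up_set (E : rel nat) N lo hi v :=
  (lo <= v <= hi) || (hi < v <= N) && ~~ covered E N hi v.

Lemma up_path (E : rel nat) N lo hi : symmetric E -> triangulated E N ->
  0 < lo -> hi < N -> exists h,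
  [/\ sorted E (rcons h N), uniq (rcons h N)
    & forall v, (v \in rcons h N) = up_set E N lo hi v].
Proof.
move=> symE triE lo0 hiN; have [side _ _] := triE.
have [t [pt lt st mt]] := up_chain triE hiN.
have [s [ss us ms]] : exists s, [/\ sorted E (s ++ t), sorted ltn (s ++ t)
    & forall v, (v \in s) = (lo <= v <= hi)].
  have [lohi|hilo] := leqP lo hi; last first.
    exists [::]; split=> /=; [exact: path_sorted pt | exact: path_sorted st |].
    by move=> v; rewrite in_nil; lia.
  exists (rcons (iota lo (hi - lo)) hi); rewrite !cat_rcons.
  have elast k : last lo (iota lo.+1 k) = lo + k.
    elim: k lo {lo0 lohi} => [|k IH] lo /=; first by rewrite addn0.
    by rewrite IH addSnnS.
  have pE k : lo + k < N -> path E lo (iota lo.+1 k).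
    elim: k lo {lo0 lohi elast} => //= k IH lo h; rewrite IH ?side //; lia.
  have main (e : rel nat) : path e lo (iota lo.+1 (hi - lo)) -> path e hi t ->
      sorted e (iota lo (hi - lo) ++ hi :: t).
    move=> p1 p2.
    have -> : iota lo (hi - lo) ++ hi :: t = lo :: (iota lo.+1 (hi - lo) ++ t).
      rewrite -cat_cons -[lo :: _]/(iota lo (hi - lo).+1) -addn1 iotaD /= -catA /=.
      by rewrite subnKC.
    by rewrite /= cat_path p1 elast subnKC.
  split; last by move=> v; rewrite mem_rcons inE mem_iota; lia.
    by apply: main => //; apply: pE; lia.
  apply: main => //; have := iota_ltn_sorted lo (hi - lo).+1; by [].
(* The climb [t] is not empty, since it ends at [N > hi]; so [N] can be split off as the final
   corner. *)
case/lastP: t pt lt st mt ss us => [_ hN|t N' _]; first by move: hN hiN => /= ->; rewrite ltnn.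
rewrite last_rcons -rcons_cat => -> _ mt ss us; exists (s ++ t); split=> //.
  by apply: sorted_uniq us; [exact: ltn_trans | exact: ltnn].
by move=> v; rewrite rcons_cat mem_cat ms mt.
Qed.

Definition jumps (E : rel nat) N :=
  [seq i <- iota 1 N.-2 | has (E i) (iota i.+2 (N - i.+1))].

Lemma mem_jumps (E : rel nat) N i :
  reflect (0 < i < N.-1 /\ exists2 j, i.+1 < j <= N & E i j) (i \in jumps E N).
Proof.
rewrite mem_filter mem_iota; apply: (iffP andP) => [[/hasP[j]]|[iN [j jN Eij]]].
  by rewrite mem_iota => h Eij iN; split; [lia | exists j => //; lia].
split; last lia.
by apply/hasP; exists j => //; rewrite mem_iota; lia.
Qed.

Lemma up_family (E : rel nat) N : symmetric E -> triangulated E N -> 0 < N ->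
  exists H : seq (seq nat),
  [/\ size H <= (size (jumps E N))./2 + 2,
      forall h, h \in H -> [/\ sorted E (rcons h N), uniq (rcons h N)
        & forall v, v \in h -> 0 < v < N]
    & forall u v, 0 < u -> u < v -> v < N -> covered E N u v ->
        exists2 h, h \in H & (u \in h) (+) (v \in h)].
Proof.
move=> symE triE N0.
(* This choice gives [K <= 2 * k] and [0 < k], which the final cases need, while [k + 1] half-paths
   still fit the size bound. *)
set K := size _; set k := K./2.+1.
(* r_i = N - 1 for all i > K. *)
pose r i := nth N.-1 (0 :: jumps E N) i.
have Kk : K <= 2 * k by rewrite /k; have := odd_double_half K; lia.
have rout i : K < i -> r i = N.-1 by move=> Ki; rewrite /r nth_default.
have rK i : 0 < i -> i <= K -> 0 < r i < N.-1.
  case: i => // i _ iK; rewrite /r /=.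
  by have /mem_jumps[] := mem_nth N.-1 iK.
have r_lt i j : i < j -> j <= K -> r i < r j.
  move=> ij jK; apply: (sorted_ltn_nth ltn_trans) => //; rewrite ?inE /=; try lia.
  rewrite (path_sortedE ltn_trans); apply/andP; split.
    by apply/allP => x /mem_jumps[]; lia.
  by apply: (sorted_filter ltn_trans); exact: iota_ltn_sorted.
have r_le_N i : r i <= N.-1.
  have [Ki|iK] := ltnP K i; first by rewrite rout.
  by case: i iK => [|i] iK; [rewrite /r /=; lia | have := rK i.+1; lia].
have r_le i j : i <= j -> r i <= r j.
  have [Kj|jK] := ltnP K j; first by rewrite (rout j).
  by rewrite leq_eqVlt => /predU1P[-> //|ij]; apply/ltnW/r_lt.
have rP w : w \in jumps E N -> exists2 a, 0 < a <= K & r a = w.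
  by move=> wJ; exists (index w (jumps E N)).+1; rewrite /r /= ?nth_index // index_mem.
have /fin_all_exists[h hP] : forall i : 'I_k.+1, exists h : seq nat,
  [/\ sorted E (rcons h N), uniq (rcons h N)
    & forall v, (v \in rcons h N) = up_set E N (r i).+1 (r (i + k)) v].
  by move=> i; apply: up_path => //; have := r_le_N (i + k); lia.
have hE i v : v < N -> (v \in h i) = up_set E N (r i).+1 (r (i + k)) v.
  by move=> vN; have [_ _ <-] := hP i; rewrite mem_rcons inE; case: eqP => [vN'|//]; lia.
exists (codom h); split.
- by rewrite size_codom card_ord /k addn2.
- move=> _ /codomP[i ->]; have [sh uh mh] := hP i; split=> // v vh.
  have := mh v; rewrite mem_rcons inE vh orbT /up_set.
  have vN : v != N by apply: contraTneq uh => <-; rewrite rcons_uniq vh.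
  have := r_le_N (i + k); lia.
move=> u v u0 uv vN cuv.
suff [i ik sep] : exists2 i, i <= k
    & up_set E N (r i).+1 (r (i + k)) u (+) up_set E N (r i).+1 (r (i + k)) v.
  have ik' : i < k.+1 by [].
  exists (h (Ordinal ik')); first exact: codom_f.
  by rewrite !hE //; lia.
(* An edge passing over [v] has span at least 2, so its left end is a jump. *)
have [w wJ [[uw wv] cwv]] : exists2 w,
    w \in jumps E N & (u <= w /\ w < v) /\ covered E N w v.
  case/coveredP: (cuv) => z [j [uz vj Ezj]]; exists z; last first.
    by split; [lia | apply/coveredP; exists z, j; split=> //; lia].
  by apply/mem_jumps; split; [lia | exists j => //; lia].
have exa : exists a, u <= r a by exists K.+1; rewrite rout //; lia.
(* [a0] is the first index with [u <= r a0], so [u] lies in the gap just after [r (a0 - 1)]. *)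
case: (ex_minnP exa) => a0 ura0 mina0.
have lta0 i : i < a0 -> r i < u by move=> ia; rewrite ltnNge; apply/negP => /mina0; lia.
have a0_gt0 : 0 < a0 by case: (posnP a0) ura0 => [->|//]; rewrite /r /=; lia.
have [a /andP[a1 aK] raw] := rP w wJ.
have a0a : a0 <= a by apply: mina0; rewrite raw.
have ra0w : r a0 <= w by rewrite -raw r_le.
(* If [a0 > k], the walk that ends at [w = r a] contains [u], and the climb from [w] misses [v]. *)
have [a0k|ka0] := leqP a0 k; last first.
  exists (a - k); first lia.
  have -> : a - k + k = a by lia.
  have := lta0 (a - k); rewrite /up_set raw cwv; lia.
(* Half-path [a0] starts after [u]. If it misses [v] too, then [v] is covered beyond its walk; so
   half-path [a0 - 1], whose walk contains [u], also misses [v]. *)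
have [va0|] := boolP (up_set E N (r a0).+1 (r (a0 + k)) v).
  by exists a0 => //; rewrite va0 /up_set; have := r_le a0 (a0 + k); lia.
rewrite /up_set negb_or !negb_and negbK => /andP[v1 v2].
have vr : r (a0 + k) < v by lia.
have cv : covered E N (r (a0.-1 + k)) v.
  apply: (@covered_anti _ _ _ (r (a0 + k))); first by apply: r_le; lia.
  by move: v2; case: covered => //; lia.
exists a0.-1; first lia.
have := lta0 a0.-1; have := r_le a0 (a0.-1 + k); have := r_le (a0.-1 + k) (a0 + k).
by rewrite /up_set cv; lia.
Qed.

(** Charge a jump [i] to the side from [i] to [i + 1], and a mirror jump to the side ending at the
    corner it stands for. A side charged twice would have crossing edges at its two ends. The
    charged sides start at 1, ..., N - 2. *)
Lemma size_jumps (E : rel nat) N : symmetric E -> triangulated E N ->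
  size (jumps E N) + size (jumps (mirror E N) N) <= N.-2.
Proof.
move=> symE [_ ncr _].
rewrite -(size_map (fun i => N.-1 - i) (jumps (mirror E N) N)) -size_cat.
rewrite -(size_iota 1 N.-2); apply: uniq_leq_size; last first.
  move=> i; rewrite mem_cat mem_iota => /orP[/mem_jumps[]|/mapP[i' /mem_jumps[]]]; lia.
rewrite cat_uniq filter_uniq ?iota_uniq //= map_inj_in_uniq ?filter_uniq ?iota_uniq //; last first.
  by move=> i j /mem_jumps[? _] /mem_jumps[]; lia.
rewrite andbT; apply/hasPn => _ /mapP[i' /mem_jumps[iN [j jN Eij]] ->].
apply/negP => /mem_jumps[_ [l lN]].
rewrite /mirror symE in Eij => Eil.
by apply: (ncr (N - j) (N.-1 - i') (N - i') l) => //; lia.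
Qed.

(** A half-path is stored as a pair: its part inside the arc [A] and its final corner. By
    [covered_or], the families of the arc and of its mirror image together separate all pairs. *)
Lemma half_paths (V : eqType) (e : rel V) (x y : V) (A : seq V) :
  symmetric e -> uniq (x :: rcons A y) ->
  triangulated (relpre (nth x (x :: rcons A y)) e) (size A).+1 ->
  exists H : seq (seq V * V),
  [/\ size H <= (size A)./2 + 4,
      forall p, p \in H -> [/\ (p.2 == x) || (p.2 == y), sorted e (rcons p.1 p.2),
        uniq (rcons p.1 p.2) & {subset p.1 <= A}]
    & forall u v, u \in A -> v \in A -> u != v ->
        exists2 p, p \in H & (u \in p.1) (+) (v \in p.1)].
Proof.
set c := x :: rcons A y; set f := nth x c; set N := (size A).+1.
move=> syme uc triE; set E := relpre f e in triE.
have symE : symmetric E by move=> i j; exact: syme.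
have szc : size c = N.+1 by rewrite /= size_rcons.
have fN : f N = y by rewrite /f /= nth_rcons ltnn eqxx.
have fA i : 0 < i < N -> f i \in A.
  by case: i => // i iN; rewrite /f /= nth_rcons ifT ?mem_nth //; lia.
have Af u : u \in A -> exists2 i, 0 < i < N & u = f i.
  move=> uA; exists (index u A).+1; first by have := uA; rewrite -index_mem; lia.
  by rewrite /f /= nth_rcons index_mem uA nth_index.
have injf i j : i <= N -> j <= N -> f i = f j -> i = j.
  by move=> iN jN /eqP; rewrite nth_uniq ?szc // => /eqP.
(* [g] is an involution of the indices: the identity for half-paths ending at [y], the reversal for
   those ending at [x]. *)
have main (g : nat -> nat) (F : rel nat) : (forall i, i <= N -> g (g i) = i) ->
    (forall i, i <= N -> g i <= N) -> (forall i, 0 < i < N -> 0 < g i < N) ->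
    F =2 relpre g E -> triangulated F N ->
  exists H : seq (seq V * V),
  [/\ size H <= (size (jumps F N))./2 + 2,
      forall p, p \in H -> [/\ p.2 = f (g N), sorted e (rcons p.1 p.2),
        uniq (rcons p.1 p.2) & {subset p.1 <= A}]
    & forall i j, 0 < i < N -> 0 < j < N -> g i < g j -> covered F N (g i) (g j) ->
        exists2 p, p \in H & (f i \in p.1) (+) (f j \in p.1)].
  move=> gK gN gI FE triF.
  have symF : symmetric F by move=> i j; rewrite !FE; exact: symE.
  have [|H [szH Hp sepH]] := up_family symF triF; first by [].
  have inj_fg : {in leq^~ N &, injective (f \o g)}.
    by move=> i j iN jN /(injf _ _ (gN i iN) (gN j jN)) gij; rewrite -(gK i) // gij gK.
  exists [seq (map (f \o g) h, f (g N)) | h <- H]; split.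
  - by rewrite size_map.
  - move=> _ /mapP[h hH ->] /=; have [sh uh mh] := Hp h hH.
    rewrite -[f (g N)]/((f \o g) N) -map_rcons; split=> //.
    + by rewrite sorted_map; move: sh; rewrite (eq_sorted FE).
    + rewrite map_inj_in_uniq // => i j ih jh; apply: inj_fg.
        by move: ih; rewrite mem_rcons inE unfold_in => /predU1P[->//|/mh]; lia.
      by move: jh; rewrite mem_rcons inE unfold_in => /predU1P[->//|/mh]; lia.
    + by move=> _ /mapP[i /mh iN ->]; apply/fA/gI.
  move=> i j iN jN gij cij.
    have [||h hH sep] := sepH _ _ _ gij _ cij; try (have := gI i; have := gI j; lia).
  exists (map (f \o g) h, f (g N)); first by apply/mapP; exists h.
  have memE k : 0 < k < N -> (f k \in map (f \o g) h) = (g k \in h).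
    move=> kN; apply/mapP/idP => [[l lh /= /injf fkl]|gkh]; last first.
      by exists (g k); rewrite //= gK //; lia.
    have [_ _ mh] := Hp h hH; have := mh l lh => lN.
    have gl : g l <= N by apply: gN; lia.
    by rewrite (_ : k = g l) ?gK //; [lia | apply: fkl; lia].
  by rewrite !memE.
have [||||HR [szR RP sepR]] := main id E _ _ _ _ triE; try by [].
have triF := triangulated_mirror symE triE.
have [||||HL [szL LP sepL]] := main (subn N) (mirror E N) _ _ _ _ triF;
  try (by []); try by (move=> *; lia).
exists (HR ++ HL); split.
- rewrite size_cat; have := size_jumps symE triE.
  have := odd_double_half (size (jumps E N)); have := odd_double_half (size (jumps (mirror E N) N)).
  have := odd_double_half (size A); lia.
- move=> p; rewrite mem_cat => /orP[/RP|/LP] [p2 *]; split=> //; rewrite p2.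
    by rewrite fN eqxx orbT.
  by rewrite subnn eqxx.
move=> u v /Af[i iN ->] /Af[j jN ->] neq.
wlog ij : i j iN jN neq / i < j.
  move=> th; case: (ltngtP i j) => [ij|ji|ij]; first exact: th.
    have [|p pH sep] := th j i jN iN _ ji; first by rewrite eq_sym.
    by exists p; rewrite // addbC.
  by rewrite ij eqxx in neq.
have [i0 jN'] : 0 < i /\ j < N by lia.
have [/(sepR i j iN jN ij)[p pR sep]|cL] := orP (covered_or symE triE i0 ij jN').
  by exists p; rewrite // mem_cat pR.
have [|p pL sep] := sepL j i jN iN _ cL; first lia.
by exists p; rewrite ?mem_cat ?pL ?orbT // addbC.
Qed.

(** * Joining half-paths of three arcs *)

Lemma is_pathE (V : finType) (e : rel V) p :
  is_path e p = [&& p != [::], sorted e p & uniq p].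
Proof. by case: p. Qed.

Lemma vsp_number_le (V : finType) (e : rel V) (P : seq (seq V)) :
  all (is_path e) P ->
  (forall u v, u != v -> exists2 p, p \in P & (u \in p) (+) (v \in p)) ->
  vsp_number e <= size P.
Proof.
move=> /allP pathP sepP.
pose S := [set p : {bseq #|V| of V} | (p : seq V) \in P].
apply: (@leq_trans #|S|); last first.
  rewrite cardE -(size_map val); apply: uniq_leq_size.
    by rewrite (map_inj_uniq val_inj) enum_uniq.
  by move=> _ /mapP[p + ->]; rewrite mem_enum inE.
apply: vsp_number_min; apply/andP; split.
  by apply/forall_inP => p; rewrite inE => /pathP.
apply/forallP => u; apply/forallP => v; apply/implyP => /sepP[p pP sep].
have := pathP p pP; rewrite is_pathE => /and3P[_ _ up].
have szp : size p <= #|V| by rewrite -(card_uniqP up) max_card.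
by apply/existsP; exists (Bseq szp); rewrite inE pP.
Qed.

(** Follow the first half-path, pass from [z] to [z'], and run back along the second. Final corners
    lie outside both arcs, so inside each arc the result meets exactly what its half-path meets. *)
Lemma join_half_paths (V : finType) (e : rel V) (T A B : seq V) (p q : seq V * V) :
  symmetric e -> {in T &, forall z z', z != z' -> e z z'} ->
  {in T, forall z, (z \notin A) && (z \notin B)} -> {in A, forall u, u \notin B} ->
  [/\ p.2 \in T, sorted e (rcons p.1 p.2), uniq (rcons p.1 p.2) & {subset p.1 <= A}] ->
  [/\ q.2 \in T, sorted e (rcons q.1 q.2), uniq (rcons q.1 q.2) & {subset q.1 <= B}] ->
  exists r, [/\ is_path e r, {in A, forall u, (u \in r) = (u \in p.1)}
              & {in B, forall u, (u \in r) = (u \in q.1)}].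
Proof.
case: p q => [p z] [q z'] /= syme cliqueT disT disAB [zT sp up pA] [zT' sq uq qB].
have rsorted s : sorted e s -> sorted e (rev s).
  by rewrite rev_sorted; apply: sub_sorted => x y; rewrite syme.
(* Equal final corners must be listed only once. *)
set q' := if z == z' then q else rcons q z'.
have memq' u : (u \in q') = (u \in q) || (z != z') && (u == z').
  by rewrite /q'; case: eqP => _; rewrite ?orbF // mem_rcons inE orbC.
have notT s u : u \in T -> {subset s <= A} \/ {subset s <= B} -> u \notin s.
  by move=> /disT/andP[uA uB] [sA|sB]; [apply: contra uA => /sA | apply: contra uB => /sB].
have TA u : u \in A -> u \notin T by move=> uA; apply: contraL uA => /disT/andP[].
have TB u : u \in B -> u \notin T by move=> uB; apply: contraL uB => /disT/andP[].
exists (rcons p z ++ rev q'); split.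
- rewrite is_pathE; apply/and3P; split; first by case: (p).
    have : sorted e (z :: rev q').
      rewrite /q'; case: eqP => [->|/eqP zz']; first by rewrite -rev_rcons rsorted.
      by rewrite rev_rcons /= cliqueT // -[path _ _ _]/(sorted e (z' :: rev q)) -rev_rcons rsorted.
    by case: (p) sp => [|x p'] //= sp ph; rewrite cat_path last_rcons sp.
  rewrite cat_uniq up rev_uniq /=; apply/andP; split; last first.
    by rewrite /q'; case: ifP => _ //; move: uq; rewrite rcons_uniq => /andP[].
  apply/hasPn => u; rewrite mem_rev memq' mem_rcons inE /= => /orP[uq'|/andP[zz' /eqP ->]].
    apply/norP; split; first by apply: contraTneq zT => <-; apply/TB/qB.
    by apply: contraL (qB _ uq') => /pA/disAB.
  by rewrite eq_sym (negbTE zz') /= notT //; left.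
- move=> u uA; rewrite mem_cat mem_rev memq' mem_rcons inE.
  have uq0 : u \in q = false by apply/negbTE; apply: contra (disAB u uA) => /qB.
  have /negbTE-> : u != z by apply: contraNneq (TA u uA) => ->.
  have /negbTE-> : u != z' by apply: contraNneq (TA u uA) => ->.
  by rewrite uq0 andbF !orbF.
- move=> u uB; rewrite mem_cat mem_rev memq' mem_rcons inE.
  have -> : u \in p = false by apply/negbTE; apply: contraL uB => /pA/disAB.
  have /negbTE-> : u != z by apply: contraNneq (TB u uB) => ->.
  have /negbTE-> : u != z' by apply: contraNneq (TB u uB) => ->.
  by rewrite andbF !orbF.
Qed.

(** List the three families one after another and join entry [i] to entry [i + M]. The total is at
    most [2 * M], so this uses every entry. *)
Lemma combine_half_paths (V : finType) (e : rel V) (T : seq V) (A : nat -> seq V)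
    (H : nat -> seq (seq V * V)) M :
  symmetric e -> T != [::] -> {in T &, forall z z', z != z' -> e z z'} ->
  (forall k z, z \in T -> z \notin A k) ->
  (forall k l u, k != l -> u \in A k -> u \notin A l) ->
  (forall k, size (H k) <= M) -> size (H 0) + size (H 1) + size (H 2) <= 2 * M ->
  (forall k p, p \in H k -> [/\ p.2 \in T, sorted e (rcons p.1 p.2),
     uniq (rcons p.1 p.2) & {subset p.1 <= A k}]) ->
  exists P : seq (seq V), [/\ size P = M, all (is_path e) P
    & forall k p, k < 3 -> p \in H k ->
        exists2 r, r \in P & {in A k, forall u, (u \in r) = (u \in p.1)}].
Proof.
move=> syme T0 cliqueT TA disA szH sz2 HP.
pose tag k := [seq (k, p) | p <- H k].
pose W := tag 0 ++ tag 1 ++ tag 2.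
have szW : size W = size (H 0) + size (H 1) + size (H 2).
  by rewrite !size_cat !size_map addnA.
have WP w : w \in W -> w.2 \in H w.1.
  by rewrite !mem_cat => /or3P[]/mapP[p pH ->].
have PW k p : k < 3 -> p \in H k -> (k, p) \in W.
  by case: k => [|[|[|//]]] _ pH; rewrite !mem_cat map_f ?orbT.
case: T T0 cliqueT TA HP => // z0 T _ cliqueT TA HP; set T' := z0 :: T in cliqueT TA HP.
pose w0 : nat * (seq V * V) := (0, ([::], z0)).
have tagE i : i < size W -> (nth w0 W i).1 =
    if i < size (H 0) then 0 else if i < size (H 0) + size (H 1) then 1 else 2.
  move=> iW; rewrite -(nth_map w0 0) // !map_cat -!map_comp /= !nth_cat !size_map.
  have sm (k : nat) j : nth 0 [seq (fst \o pair k) p | p <- H k] j =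
      if j < size (H k) then k else 0.
    case: ltnP => jk; last by rewrite nth_default // size_map.
    by rewrite (nth_map ([::], z0)).
  rewrite !sm; rewrite szW in iW; do !case: ifP; lia.
have /fin_all_exists[r rP] : forall i : 'I_M, exists r, is_path e r /\
    forall j, j < size W -> (j = i :> nat \/ j = i + M) ->
      {in A (nth w0 W j).1, forall u, (u \in r) = (u \in (nth w0 W j).2.1)}.
  move=> i; have iM := ltn_ord i.
  have [iW|Wi] := ltnP i (size W); last first.
    (* A path on a single corner pads the list to exactly [M] paths. *)
    by exists [:: z0]; split=> // j jW h; exfalso; lia.
  have := HP _ _ (WP _ (mem_nth w0 iW)).
  have [i2W|Wi2] := ltnP (i + M) (size W); last first.
    case=> zT sp up pA; exists (rcons (nth w0 W i).2.1 (nth w0 W i).2.2); split.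
      by rewrite is_pathE sp up; case: (_.2.1).
    move=> j jW [->|jE]; last by exfalso; lia.
    move=> u uA; rewrite mem_rcons inE; case: eqP => // uz; rewrite uz in uA.
    by have := TA (nth w0 W i).1 _ zT; rewrite uA.
  move=> g1; have g2 := HP _ _ (WP _ (mem_nth w0 i2W)).
  (* No H k has more than M members, so entries M apart have different tags. *)
  have tne : (nth w0 W i).1 != (nth w0 W (i + M)).1.
    have := i2W; rewrite szW => i2W'.
    by rewrite !tagE //; have := szH 0; have := szH 1; have := szH 2; do !case: ifP; lia.
  have [||r [pr r1 r2]] := join_half_paths syme cliqueT _ _ g1 g2.
  - by move=> z zT; rewrite !TA.
  - by move=> u; apply: disA.
  by exists r; split=> // j jW [|] ->.
exists (codom r); split; first by rewrite size_codom card_ord.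
  by apply/allP => _ /codomP[i ->]; have [] := rP i.
move=> k p k3 /(PW k p k3) kW; pose j := index (k, p) W.
have jW : j < size W by rewrite index_mem.
have [jM|Mj] := ltnP j M.
  exists (r (Ordinal jM)); first exact: codom_f.
  by have [_ /(_ j jW (or_introl erefl))] := rP (Ordinal jM); rewrite nth_index.
have jM : j - M < M by lia.
exists (r (Ordinal jM)); first exact: codom_f.
have [_ /(_ j jW)] := rP (Ordinal jM); rewrite nth_index //; apply; right => /=; lia.
Qed.

(** * Subpolygons and rotations of a triangulation *)

Lemma triangulated_ext (E E' : rel nat) N :
  (forall i j, i <= N -> j <= N -> E i j = E' i j) -> triangulated E N -> triangulated E' N.
Proof.
move=> EE' [side ncr maxE]; split.
- by move=> i iN; rewrite -EE' ?side //; lia.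
- by move=> i j k l ij jk kl lN; rewrite -!EE'; try lia; apply: ncr.
move=> i j ij jN; rewrite -EE'; [|lia|lia] => /(maxE _ _ ij jN)[c [d [h1 h2 Ecd]]].
by exists c, d; rewrite -EE' //; lia.
Qed.

(** The edge [lo hi] cuts off a smaller polygon: an edge leaving its interior corners for the other
    side would cross [lo hi]. *)
Lemma triangulated_sub (E : rel nat) N lo hi : triangulated E N -> symmetric E ->
  hi <= N -> E lo hi -> triangulated (fun i j => E (lo + i) (lo + j)) (hi - lo).
Proof.
move=> [side ncr maxE] symE hiN Elh; split.
- by move=> i ih; rewrite addnS side //; lia.
- by move=> i j k l ij jk kl lN; apply: ncr; lia.
move=> i j ij jh nE; have [||c [d [icj dout Ecd]]] := maxE _ _ _ _ nE; try lia.
have Edc : E d c by rewrite symE.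
have dlo : lo <= d by rewrite leqNgt; apply/negP => dlo; apply: (ncr d lo c hi); lia.
have dhi : d <= hi by rewrite leqNgt; apply/negP => dhi; apply: (ncr lo c hi d); lia.
by exists (c - lo), (d - lo); rewrite !subnKC //; try lia; split=> //; lia.
Qed.

(** Crossing depends only on the cyclic order. The corner [N], which [r] sends to 0, is treated
    separately. *)
Lemma triangulated_rot1 (E : rel nat) N : triangulated E N -> symmetric E ->
  let r i := if i < N then i.+1 else 0 in triangulated (relpre r E) N.
Proof.
move=> [side ncr maxE] symE r.
have E0N : 0 < N -> E 0 N.
  move=> N0; apply: contraT => nE; have [||c [d [? ? ?]]] := maxE _ _ _ _ nE; lia.
split.
- move=> i iN; rewrite /r /= iN; case: ltnP => [/side //|iN'].
  by rewrite symE (_ : i.+1 = N) ?E0N //; lia.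
- move=> i j k l ij jk kl lN; rewrite /r /=.
  have -> : i < N by lia.
  have -> : j < N by lia.
  have -> : k < N by lia.
  case: ltnP => lN'; first by apply: ncr; lia.
  by move=> Eik Ej0; rewrite symE in Ej0; apply: (ncr 0 i.+1 j.+1 k.+1) => //; lia.
move=> i j ij jN; rewrite /r /=.
have -> : i < N by lia.
case: ltnP => jN' nE.
  have [||c [d [icj dout Ecd]]] := maxE _ _ _ _ nE; try lia.
  have c0 : c = c.-1.+1 by lia.
  (* The end 0 is the image of [N]. *)
  have [d0|d0] := posnP d.
    exists c.-1, N; rewrite ltnn; have -> : c.-1 < N by lia.
    by rewrite -c0 -d0; split=> //; lia.
  exists c.-1, d.-1; have -> : c.-1 < N by lia.
  have -> : d.-1 < N by lia.
  by rewrite -c0 (prednK d0); split=> //; lia.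
(* Here [j = N] becomes 0, so the chord is read from 0 to [i + 1], and the ends of the crossing edge
   swap roles. *)
rewrite symE in nE; have [||c [d [icj dout Ecd]]] := maxE _ _ _ _ nE; try lia.
have [c0 d0] : c = c.-1.+1 /\ d = d.-1.+1 by lia.
exists d.-1, c.-1; have -> : c.-1 < N by lia.
have -> : d.-1 < N by lia.
by rewrite -c0 -d0 symE; split=> //; lia.
Qed.

Lemma triangulated_rot (V : eqType) (e : rel V) x0 c k : symmetric e ->
  triangulated (relpre (nth x0 c) e) (size c).-1 ->
  triangulated (relpre (nth x0 (rot k c)) e) (size c).-1.
Proof.
move=> syme tri; have [kc|ck] := leqP k (size c); last by rewrite rot_oversize // ltnW.
elim: k kc => [|k IH] kc; first by rewrite rot0.
have symE : symmetric (relpre (nth x0 (rot k c)) e) by move=> i j; exact: syme.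
apply: triangulated_ext (triangulated_rot1 (IH (ltnW kc)) symE).
move=> i j iN jN; rewrite /= rotS //.
have sz : size (rot k c) = size c by rewrite size_rot.
case: (rot k c) sz => [|x s] /= sz; first by move: kc; rewrite -sz.
rewrite rot1_cons !nth_rcons -sz /= .
have nE m : m <= size s ->
    (if m < size s then nth x0 s m else if m == size s then x else x0) =
    nth x0 (x :: s) (if m < size s then m.+1 else 0).
  by move=> ms; case: ltnP => //= sm; rewrite ifT //; lia.
by rewrite !nE //; move: iN jN; rewrite -sz.
Qed.

Lemma triangulated_infix (V : eqType) (e : rel V) x0 s1 x A y s2 :
  symmetric e -> e x y ->
  triangulated (relpre (nth x0 (s1 ++ (x :: rcons A y) ++ s2)) e)
    (size (s1 ++ (x :: rcons A y) ++ s2)).-1 ->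
  triangulated (relpre (nth x (x :: rcons A y)) e) (size A).+1.
Proof.
move=> syme exy tri.
set c := s1 ++ _ ++ s2 in tri.
have nE i : i <= (size A).+1 -> nth x0 c (size s1 + i) = nth x (x :: rcons A y) i.
  move=> iA; rewrite /c nth_cat ltnNge leq_addr addKn nth_cat /= size_rcons ltnS iA.
  by apply: set_nth_default; rewrite /= size_rcons.
have symE : symmetric (relpre (nth x0 c) e) by move=> i j; exact: syme.
have szc : size c = size s1 + (size A).+2 + size s2 by rewrite !size_cat /= size_rcons addnA.
have [hN Elh] : size s1 + (size A).+1 <= (size c).-1 /\
    relpre (nth x0 c) e (size s1) (size s1 + (size A).+1).
  split; first by rewrite szc; lia.
  by rewrite /= -{1}[size s1]addn0 !nE //= nth_rcons ltnn eqxx.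
have := triangulated_sub tri symE hN Elh; rewrite addKn; apply: triangulated_ext => i j iA jA.
by rewrite /= !nE.
Qed.

(** * The central triangle and its three arcs *)

(** Among the edges of span above [N / 2], such as [0 N], take one of least span and the triangle on
    its inner side. The other two sides of the triangle are shorter, so by minimality they span at
    most [N / 2]. *)
Lemma balanced_triangle (E : rel nat) N : symmetric E -> triangulated E N -> 1 < N ->
  exists i t j, [/\ i < t < j, j <= N, E i t, E t j & E i j] /\
    [/\ 2 * (t - i) <= N.+1, 2 * (j - t) <= N.+1 & N < 2 * (j - i)].
Proof.
move=> symE triE N1.
pose P d := (N < 2 * d) && has (fun i => E i (i + d)) (iota 0 (N.+1 - d)).
have exP : exists d, P d.
  exists N; apply/andP; split; first lia.
  apply/hasP; exists 0; first by rewrite mem_iota; lia.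
  rewrite add0n; apply: contraT => nE; have [_ _ maxE] := triE.
  by have [||c [d [? ? ?]]] := maxE _ _ _ _ nE; lia.
case: (ex_minnP exP) => d /andP[Nd /hasP[i]]; rewrite mem_iota => iN Eid mind.
have Pd l m : l < m -> m <= N -> E l m -> N < 2 * (m - l) -> d <= m - l.
  move=> lm mN Elm h; apply: mind; rewrite /P h; apply/hasP; exists l.
    by rewrite mem_iota; lia.
  by rewrite subnKC // ltnW.
have [||t [itd Eit Etd]] := inner_triangle symE triE _ _ Eid; try lia.
exists i, t, (i + d); split; first by split=> //; lia.
have := Pd i t; have := Pd t (i + d); rewrite Eit Etd; split; lia.
Qed.

Lemma split_drop (V : Type) (x0 : V) (s : seq V) i j : i < j -> j <= size s ->
  drop i s = nth x0 s i :: take (j - i.+1) (drop i.+1 s) ++ drop j s.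
Proof.
move=> ij js; rewrite (drop_nth x0); last lia.
by rewrite -{1}[drop i.+1 s](cat_take_drop (j - i.+1)) drop_drop subnK.
Qed.

Lemma outer_cycle (V : finType) (e : rel V) (x0 : V) : maximal_outerplanar e ->
  exists c, [/\ uniq c, c =i V & triangulated (relpre (nth x0 c) e) (size c).-1].
Proof.
case=> [[syme _] V2 [corner [bijc sides ncr maxc]]]; exists (codom corner).
have nthE (i : 'I_#|V|) : nth x0 (codom corner) i = corner i.
  by rewrite (nth_map i) ?size_enum_ord // nth_ord_enum.
split.
- by rewrite map_inj_uniq ?enum_uniq //; exact: bij_inj.
- by move=> u; case: bijc => g _ gK; rewrite -(gK u) codom_f.
rewrite size_codom card_ord; split.
- move=> i iV; have i1 : i < #|V| by lia. 
  have i2 : i.+1 < #|V| by lia.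
  by have := sides (Ordinal i1); rewrite -!nthE /= (modn_small i2).
- move=> i j k l ij jk kl lN.
  have [i' j' k' l'] : [/\ i < #|V|, j < #|V|, k < #|V| & l < #|V|] by split; lia.
  have := ncr (Ordinal i') (Ordinal k') (Ordinal j') (Ordinal l').
  rewrite -!nthE /= /chords_cross /= => h Eik Ejl; have := h Eik Ejl; lia.
move=> i j ij jN; have [i' j'] : i < #|V| /\ j < #|V| by lia.
have := maxc (Ordinal i') (Ordinal j'); rewrite -!nthE /chords_cross /= => h nE.
have [|c [d /andP[Ecd cr]]] := h _ nE; first by rewrite -val_eqE /=; lia.
have := ltn_ord c; have := ltn_ord d => dV cV.
(* [chords_cross] leaves open which end of the crossing edge lies between [i] and [j]. *)
have [icj|icj] := boolP (i < c < j); [exists c, d | exists d, c]; rewrite /= !nthE.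
  by split=> //; lia.
by rewrite syme; split=> //; lia.
Qed.

Lemma arc_path (V : finType) (e : rel V) x A y :
  triangulated (relpre (nth x (x :: rcons A y)) e) (size A).+1 ->
  uniq (x :: rcons A y) -> is_path e (x :: A).
Proof.
move=> [side _ _]; rewrite -rcons_cons rcons_uniq is_pathE => /andP[_ ->].
rewrite andbT; apply/andP; split=> //; apply/(sortedP x) => i iA.
have nE k : k < size (x :: A) -> nth x (x :: rcons A y) k = nth x (x :: A) k.
  by rewrite -rcons_cons nth_rcons => ->.
by rewrite -!nE ?(ltnW iA) //; apply: side; apply: ltnW.
Qed.

Lemma disjoint_arcs (V : eqType) (a b d : V) A1 A2 A3 :
  uniq (a :: A1 ++ b :: A2 ++ d :: A3) ->
  let A k := nth [::] [:: A1; A2; A3] k in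
  (forall k l u, k != l -> u \in A k -> u \notin A l) /\
  (forall k z, z \in [:: a; b; d] -> z \notin A k).
Proof.
move=> uc A.
(* Counted with multiplicity, each vertex occurs at most once in the cycle; this makes all
   disjointness claims arithmetic. *)
have cntE u : (a == u) + count_mem u A1 + ((b == u) + count_mem u A2) +
    ((d == u) + count_mem u A3) <= 1.
  have := count_uniq_mem u uc; rewrite /= count_cat /= count_cat /= !addnA => ->.
  exact: leq_b1.
have memE u s : (u \in s) = (0 < count_mem u s) by rewrite -has_pred1 has_count.
split=> [k l u|k z]; rewrite !memE.
  move=> kl; have := cntE u.
  by move: k l kl => [|[|[|k]]] [|[|[|l]]] //; rewrite /A /= ?nth_nil //=; clear; lia.
by have := cntE z; case: k => [|[|[|k]]]; rewrite /A /= ?nth_nil //=; clear; lia.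
Qed.

(** * The upper bound *)

(** With [M = n %/ 4 + 8], no family of half-paths exceeds [M], and by the next lemma the three
    together have at most [2 * M] members. *)
Lemma half_le m n : 2 * m <= n -> m./2 + 4 <= n %/ 4 + 8.
Proof. lia. Qed.

Lemma half_sum_le h1 h2 h3 m1 m2 m3 :
  h1 <= m1./2 + 4 -> h2 <= m2./2 + 4 -> h3 <= m3./2 + 4 ->
  h1 + h2 + h3 <= 2 * ((m1 + m2 + m3 + 3) %/ 4 + 8).
Proof. lia. Qed.

(** Of the constant 14, 8 comes from [M] and 6 from the paths in [extra]. *)
Lemma vsp_number_outerplanar (V : finType) (e : rel V) : 3 < #|V| ->
  maximal_outerplanar e -> vsp_number e <= #|V| %/ 4 + 14.
Proof.
move=> V3 outer; have [[syme irre] _ _] := outer.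
have /card_gt0P[x0 _] : 0 < #|V| by lia.
have [c [uc cV tric]] := outer_cycle x0 outer.
have szc : size c = #|V| by rewrite -(card_uniqP uc) (eq_card cV).
have c3 : 3 < size c by rewrite szc.
have symE : symmetric (relpre (nth x0 c) e) by move=> i j; exact: syme.
have [|i [t [j [[itj jN Eit Etj Eij] [ti jt ij]]]]] := balanced_triangle symE tric; first lia.
(* The cycle is rotated to start at the corner [a]; the third arc wraps around the end of the old
   numbering. *)
have [a [A1 [b [A2 [d [A3 [rc [ab bd ad] [sz1 sz2 sz3]]]]]]]] : exists a A1 b A2 d A3,
  [/\ rot i c = a :: A1 ++ b :: A2 ++ d :: A3, [/\ e a b, e b d & e a d]
    & [/\ 2 * size A1 <= #|V|, 2 * size A2 <= #|V| & 2 * size A3 <= #|V|]].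
  exists (nth x0 c i), (take (t - i.+1) (drop i.+1 c)), (nth x0 c t),
    (take (j - t.+1) (drop t.+1 c)), (nth x0 c j), (drop j.+1 c ++ take i c).
  split; [|split; [exact: Eit|exact: Etj|exact: Eij]|]; last first.
    by rewrite size_cat !size_take_min !size_drop; split; lia.
  have [tc [jc jc1]] : t <= size c /\ (j <= size c /\ j < size c) by lia.
  rewrite /rot (@split_drop _ x0 _ i t) 1?(@split_drop _ x0 _ t j) 1?(@drop_nth _ x0 j) //; try lia.
  by rewrite /= -!catA /= -!catA.
have uc' : uniq (a :: A1 ++ b :: A2 ++ d :: A3) by rewrite -rc rot_uniq.
have memV u : u \in a :: A1 ++ b :: A2 ++ d :: A3 by rewrite -rc mem_rot cV.
have szV : size A1 + size A2 + size A3 + 3 = #|V|.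
  by have := congr1 size rc; rewrite size_rot szc /= size_cat /= size_cat /= => ->; lia.
have tri1 := triangulated_rot i syme tric.
rewrite -(size_rot i c) rc in tri1.
set c' := a :: _ in uc' memV tri1.
have [c1E c2E] : c' = [::] ++ (a :: rcons A1 b) ++ (A2 ++ d :: A3) /\
    c' = (a :: A1) ++ (b :: rcons A2 d) ++ A3 by rewrite /= !cat_rcons.
(* A second rotation makes the third arc contiguous with both its corners [d] and [a]. *)
have c3E : rot (size ((a :: A1) ++ b :: A2)) c' =
    [::] ++ (d :: rcons A3 a) ++ (A1 ++ b :: A2).
  rewrite (_ : c' = ((a :: A1) ++ b :: A2) ++ d :: A3); last by rewrite -catA.
  by rewrite rot_size_cat /= cat_rcons.
have tri3 := triangulated_rot (size ((a :: A1) ++ b :: A2)) syme tri1.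
have u3 : uniq (rot (size ((a :: A1) ++ b :: A2)) c') by rewrite rot_uniq.
rewrite -(size_rot (size ((a :: A1) ++ b :: A2)) c') c3E in tri3.
have sub_uniq (s1 s2 s3 : seq V) : uniq (s1 ++ s2 ++ s3) -> uniq s2.
  by rewrite !cat_uniq => /and3P[_ _ /andP[]].
have u1 := uc'; rewrite c1E in u1; have {}u1 := sub_uniq _ _ _ u1.
have u2 := uc'; rewrite c2E in u2; have {}u2 := sub_uniq _ _ _ u2.
rewrite c3E in u3; have {}u3 := sub_uniq _ _ _ u3.
have t1 := tri1; rewrite c1E in t1; have {}t1 := triangulated_infix syme ab t1.
have t2 := tri1; rewrite c2E in t2; have {}t2 := triangulated_infix syme bd t2.
have da : e d a by rewrite syme.
have t3 := triangulated_infix syme da tri3.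
have [H1 [szH1 HP1 sep1]] := half_paths syme u1 t1.
have [H2 [szH2 HP2 sep2]] := half_paths syme u2 t2.
have [H3 [szH3 HP3 sep3]] := half_paths syme u3 t3.
pose A k := nth [::] [:: A1; A2; A3] k.
pose H k := nth [::] [:: H1; H2; H3] k.
pose T := [:: a; b; d].
have [disA TA] : (forall k l u, k != l -> u \in A k -> u \notin A l) /\
  (forall k z, z \in T -> z \notin A k) := disjoint_arcs uc'.
have cliqueT : {in T &, forall z z', z != z' -> e z z'}.
  move=> z z'; rewrite !inE => /or3P[]/eqP-> /or3P[]/eqP->; rewrite ?eqxx // => _;
    by rewrite // syme.
pose M := #|V| %/ 4 + 8.
have [|||P [szP pathP sepP]] := @combine_half_paths V e T A H M syme isT cliqueT TA disA.
- move=> k; apply: (@leq_trans ((size (A k))./2 + 4)).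
    by case: k => [|[|[|k]]]; rewrite /H /A /= ?nth_nil.
  apply: half_le; by case: k => [|[|[|k]]]; rewrite /A /= ?nth_nil.
- by rewrite /M -szV; apply: half_sum_le.
- move=> [|[|[|k]]] p; rewrite /H /= ?nth_nil //.
  + by case/HP1=> /orP[]/eqP->; split; rewrite // !inE eqxx ?orbT.
  + by case/HP2=> /orP[]/eqP->; split; rewrite // !inE eqxx ?orbT.
  + by case/HP3=> /orP[]/eqP->; split; rewrite // !inE eqxx ?orbT.
(* The singletons separate each corner from everything else, and the last three paths separate
   vertices of different arcs. Only pairs within one arc are left to [P]. *)
pose extra := [:: [:: a]; [:: b]; [:: d]; a :: A1; b :: A2; d :: A3].
have sizeE : #|V| %/ 4 + 14 = size (P ++ extra) by rewrite size_cat szP /M -addnA.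
rewrite sizeE; apply: vsp_number_le.
  have /= := And3 (arc_path t1 u1) (arc_path t2 u2) (arc_path t3 u3).
  by rewrite all_cat pathP /= => -[-> -> ->].
have memA u : u \in T \/ exists2 k, k < 3 & u \in A k.
  have := memV u; rewrite inE mem_cat inE mem_cat inE => /orP[|/orP[|/orP[|/orP[|/orP[]]]]].
  - by move=> ua; left; rewrite inE ua.
  - by move=> uA; right; exists 0.
  - by move=> ua; left; rewrite !inE ua orbT.
  - by move=> uA; right; exists 1.
  - by move=> ua; left; rewrite !inE ua !orbT.
  - by move=> uA; right; exists 2.
move=> u v uv.
have sepT z z' : z != z' -> z \in T -> exists2 p, p \in P ++ extra & (z \in p) (+) (z' \in p).
  move=> zz' zT; exists [:: z]; last by rewrite !inE eqxx [z' == z]eq_sym (negbTE zz').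
  by move: zT; rewrite mem_cat !inE => /or3P[]/eqP->; rewrite eqxx ?orbT.
have [uT|[k k3 uA]] := memA u; first exact: sepT.
have [vT|[l l3 vA]] := memA v.
  by have [|p pP sep] := sepT v u _ vT; rewrite 1?eq_sym //; exists p; rewrite // addbC.
have [kl|kl] := eqVneq k l.
  subst l; have [p pH sep] : exists2 p, p \in H k & (u \in p.1) (+) (v \in p.1).
    clear l3; case: k k3 uA vA => [|[|[|//]]] _ uA vA; [exact: sep1|exact: sep2|exact: sep3].
  have [r rP rE] := sepP k p k3 pH; exists r; first by rewrite mem_cat rP.
  by rewrite !rE.
exists (nth a T k :: A k).
  by rewrite mem_cat !inE; case: k k3 {uA kl} => [|[|[|//]]] _; rewrite eqxx ?orbT.
have kT : nth a T k \in T by apply: mem_nth.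
rewrite !inE uA orbT; have /negbTE-> : v \notin A k by apply: disA vA; rewrite eq_sym.
suff /negbTE-> : v != nth a T k by [].
by apply: contraTneq vA => ->; apply: TA.
Qed.

(** * The fan is maximal outerplanar *)

Lemma fan_maximal_outerplanar n : 3 < n -> maximal_outerplanar (@fan n).
Proof.
move=> n3; have cV : #|{: option 'I_n.-1}| = n by rewrite card_fan //; lia.
have symf : symmetric (@fan n) by case=> [i|] [j|] //=; rewrite orbC.
split; [split=> // |by rewrite cV; lia|].
  by case=> [i|] //=; apply/negbTE; lia.
(* The apex sits at corner 0, the path on the corners 1, ..., n - 1. *)
pose corner (i : 'I_#|{: option 'I_n.-1}|) : option 'I_n.-1 :=
  if nat_of_ord i is k.+1 then insub k else None.
have cornerS (k : 'I_n.-1) : exists i, corner i = Some k /\ nat_of_ord i = k.+1.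
  have kV : k.+1 < #|{: option 'I_n.-1}| by rewrite cV; have := ltn_ord k; lia.
  by exists (Ordinal kV); rewrite /corner /= valK.
have V0 : 0 < #|{: option 'I_n.-1}| by rewrite cV; lia.
have cornerP (i : 'I_#|{: option 'I_n.-1}|) :
    (nat_of_ord i = 0 /\ corner i = None) \/
    exists2 k : 'I_n.-1, nat_of_ord i = k.+1 & corner i = Some k.
  rewrite /corner; case: i => -[|k] iV /=; [by left | right].
  have kn : k < n.-1 by move: iV; rewrite cV; lia.
  by exists (Ordinal kn); rewrite // insubT.
have corner_inj : injective corner.
  move=> i j; case: (cornerP i) (cornerP j) => [[i0 ->]|[k ik ->]] [[j0 ->]|[l jl ->]] //.
    by move=> _; apply: val_inj; rewrite /= i0 j0.
  by case=> kl; apply: val_inj; rewrite /= ik jl kl.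
have fanE (i j : 'I_#|{: option 'I_n.-1}|) : fan (corner i) (corner j) =
    (i != j :> nat) && [|| i == 0 :> nat, j == 0 :> nat, i.+1 == j | j.+1 == i].
  case: (cornerP i) (cornerP j) => [[-> ->]|[k -> ->]] [[-> ->]|[l -> ->]]; rewrite /fan //=; lia.
have ltV (i : 'I_#|{: option 'I_n.-1}|) : i < n by have := ltn_ord i; rewrite [X in _ < X]cV.
exists corner; split.
- by apply: inj_card_bij => //; rewrite card_ord.
- move=> i; have ordSE m (k : 'I_m) : m = n -> ordS k = k.+1 %% n :> nat by move=> <-.
  rewrite fanE (ordSE _ i cV); move: (nat_of_ord i) (ltV i) => {}i iV.
  have [iV'|Vi] := ltnP i.+1 n; first by rewrite modn_small //; lia.
  by rewrite (_ : i.+1 = n) ?modnn; lia.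
- move=> a b c d; rewrite !fanE /chords_cross.
  by move: (nat_of_ord a) (nat_of_ord b) (nat_of_ord c) (nat_of_ord d) => {}a {}b {}c {}d; lia.
move=> a b; rewrite fanE -val_eqE => /= ab nE.
have lt_max : (minn a b).+1 < #|{: option 'I_n.-1}|.
  move: ab (ltV a) (ltV b); clear nE.
  by move: (nat_of_ord a) (nat_of_ord b) => {}a {}b; rewrite cV; lia.
(* A missing chord avoids corner 0 and skips a corner, so the edge from the apex to the corner just
   after its smaller end crosses it. *)
exists (Ordinal V0), (Ordinal lt_max); rewrite fanE /chords_cross /=.
by clear lt_max; move: ab nE; move: (nat_of_ord a) (nat_of_ord b) => {}a {}b; lia.
Qed.

(** * The lower bound for the fan *)

Definition cuts n (p : seq (option 'I_n)) :=
  [set i : 'I_n | (Some i \in p) (+) (Some (ordS i) \in p)].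

(** Only the two cyclic pairs containing [x] can change. *)
Lemma card_cuts_cons n (p : seq (option 'I_n)) x : #|cuts (Some x :: p)| <= #|cuts p| + 2.
Proof.
apply: (@leq_trans #|cuts p :|: [set x; ord_pred x]|); last first.
  by rewrite (leq_trans (leq_card_setU _ _)) // leq_add2l cards2; case: (_ != _).
apply/subset_leq_card/subsetP => i; rewrite !inE.
have -> : (Some (ordS i) == Some x) = (i == ord_pred x).
  by rewrite -[x in LHS]ord_predK (inj_eq Some_inj) (inj_eq (can_inj (@ordSK n))).
rewrite (inj_eq Some_inj).
by case: (i == x); case: (i == ord_pred x); rewrite ?orbT ?orbF.
Qed.

(** The pair of [x] and [y] was cut and no longer is; at most the other pair at [x] becomes cut in
    exchange. *)
Lemma card_cuts_cons_adj n (p : seq (option 'I_n)) x y : Some x \notin p -> Some y \in p ->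
  (y == ordS x) || (x == ordS y) -> #|cuts (Some x :: p)| <= #|cuts p|.
Proof.
move=> xp yp xy.
have ordS_pred z : (Some (ordS z) == Some x) = (z == ord_pred x).
  by rewrite -[x in LHS]ord_predK (inj_eq Some_inj) (inj_eq (can_inj (@ordSK n))).
have le_swap z z' : z \in cuts p -> z \notin cuts (Some x :: p) ->
    cuts (Some x :: p) \subset z' |: cuts p -> #|cuts (Some x :: p)| <= #|cuts p|.
  move=> zp zn /subsetP sub; rewrite [in leqRHS](cardsD1 z) zp.
  apply: (@leq_trans #|z' |: cuts p :\ z|).
    apply/subset_leq_card/subsetP => i ip; have := sub i ip; rewrite !inE => /predU1P[->|].
      by rewrite eqxx.
    by move=> ->; rewrite (contraNneq _ zn) ?orbT // => <-.
  by rewrite (leq_trans (leq_card_setU _ _)) // cards1.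
case/orP: xy => /eqP xy.
- apply: (le_swap x (ord_pred x)).
  + by rewrite inE (negbTE xp) -xy.
  + by rewrite !inE eqxx -xy yp orbT.
  apply/subsetP => i; rewrite !inE ordS_pred (inj_eq Some_inj).
  have [->|_] := eqVneq i (ord_pred x); first by [].
  by have [->|_ //] := eqVneq i x; rewrite -xy yp orbT.
- apply: (le_swap y x).
  + by rewrite inE yp -xy (negbTE xp).
  + by rewrite !inE yp orbT -xy eqxx.
  apply/subsetP => i; rewrite !inE ordS_pred (inj_eq Some_inj).
  have [//|_] := eqVneq i x.
  have [iy|//] := eqVneq i (ord_pred x).
  have -> : i = y by rewrite iy xy ordSK.
  by rewrite yp.
Qed.

Lemma card_cuts_path n (p : seq (option 'I_n.-1)) : is_path (@fan n) p -> #|cuts p| <= 4.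
Proof.
(* The invariant allows two cuts for the run of path vertices at the head, if the head is not the
   apex, and two more once the apex has been met. The apex occurs at most once, so there are at most
   two runs. *)
suff bound x s : path (@fan n) x s -> uniq (x :: s) ->
    #|cuts (x :: s)| <= 2 * (x != None) + 2 * (None \in x :: s).
  case: p => // x s /andP[ps us]; apply: leq_trans (bound x s ps us) _.
  by case: (x != None); case: (None \in _).
have cutsN q : cuts (None :: q) = cuts q :> {set 'I_n.-1} by apply/setP => i; rewrite !inE.
have cuts0 : #|cuts (Nil (option 'I_n.-1))| = 0.
  by apply/eqP; rewrite cards_eq0; apply/eqP/setP => i; rewrite !inE.
elim: s x => [|y s IH] x.
  case: x => [x|] _ _; last by rewrite cutsN cuts0.
  by rewrite (leq_trans (card_cuts_cons _ _)) // cuts0.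
move=> /= /andP[exy ps] /andP[xs us]; have := IH y ps us.
case: x exy xs => [x|] exy xs.
  case: y exy xs ps us => [y|] exy xs ps us.
    move=> h; apply: leq_trans (leq_trans _ h) _; last by rewrite !inE.
    apply: (card_cuts_cons_adj xs (mem_head _ _)).
    have xn := ltn_ord x; have yn := ltn_ord y.
    move: exy; rewrite /fan -!val_eqE /= => /orP[]/eqP xy; apply/orP; [left|right].
      by rewrite xy modn_small.
    by rewrite xy modn_small.
  move=> h; rewrite (leq_trans (card_cuts_cons _ _)) //.
  by move: h; rewrite !inE /=; lia.
rewrite cutsN; case: y exy xs ps us => // y _ xs _ _.
by move: xs; rewrite !inE /= => /negbTE->; lia.
Qed.

Lemma vsp_number_fan n : 3 < n -> n.-1 <= 4 * vsp_number (@fan n).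
Proof.
move=> n3; have [S /andP[/forall_inP pS /forallP sep] <-] := vsp_number_attained (@fan n).
(* The sum is at most four per path, and it is at least [n - 1] because the cuts of the paths in [S]
   cover all cyclic pairs. *)
apply: (@leq_trans (\sum_(p in S) #|cuts (p : seq (option 'I_n.-1))|)); last first.
  rewrite mulnC -sum_nat_const; apply: leq_sum => p /pS; exact: card_cuts_path.
apply: (@leq_trans #|[set: 'I_n.-1]|); first by rewrite cardsT card_ord.
apply: (@leq_trans #|\bigcup_(p in S) cuts (p : seq (option 'I_n.-1))|); last first.
  apply: (big_ind2 (fun (A : {set _}) k => #|A| <= k)) => [|A k B l Ak Bl|//].
    by rewrite cards0.
  exact: leq_trans (leq_card_setU _ _) (leq_add Ak Bl).
apply/subset_leq_card/subsetP => i _; apply/bigcupP.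
have /forallP/(_ (Some (ordS i)))/implyP := sep (Some i).
have : Some i != Some (ordS i).
  rewrite (inj_eq Some_inj) -val_eqE /=; have := ltn_ord i => iV.
  have [i1|i1] := ltnP i.+1 n.-1; first by rewrite modn_small //; lia.
  by rewrite (_ : i.+1 = n.-1) ?modnn; lia.
by move=> neq /(_ neq)/existsP[p /andP[pS' sp]]; exists p; rewrite // inE.
Qed.

(** * Both bounds over the rationals *)

Import Order.TTheory GRing.Theory Num.Theory.
Local Open Scope ring_scope.

Theorem theorem15 :
  (exists C : rat, forall n : nat, (3 < n)%N ->
     forall (V : finType) (e : rel V), #|V| = n -> maximal_outerplanar e ->
       (vsp_number e)%:R <= n%:R / 4%:R + C)
  /\
  (forall n : nat, (3 < n)%N ->
     maximal_outerplanar (@fan n) /\ (n%:R - 1) / 4%:R <= (vsp_number (@fan n))%:R :> rat).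
Proof.
split.
  exists 14%:R => n n3 V e Vn outer.
  have := vsp_number_outerplanar; rewrite -Vn in n3 *.
  move=> /(_ V e n3 outer) le_v.
  apply: (@le_trans _ _ (#|V| %/ 4 + 14)%N%:R); first by rewrite ler_nat.
  by rewrite natrD lerD2r ler_pdivlMr ?ltr0n // -natrM ler_nat leq_divM.
move=> n n3; split; first exact: fan_maximal_outerplanar.
have n_gt0 : (0 < n)%N by apply: leq_trans n3.
rewrite ler_pdivrMr ?ltr0n // -natrM -{1}(prednK n_gt0) -natr1 addrK ler_nat mulnC.
exact: vsp_number_fan.
Qed.
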